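(* Let $G=(V=[n],E=[m])$ be an undirected graph with vertex-edge incidence matrix $A\in\{0,1\}^{n\times m}$, let $b\in\mathbb{R}^m$, and let $Q=(q_{ij})\in\mathbb{R}^{m\times m}$ be symmetric with $q_{ii}=0$ for all $i$ and $q_{ij}\le 0$ for all $i,j$. Consider the quadratic matching game $$\nu(w)=\max_{x\in\{0,1\}^m}\left[b^Tx+x^TQx:\ Ax\le w\right],\qquad w\in\{0,1\}^n.$$ Let $G'=(E,E')$ be the graph on vertex set $E$ whose edges are the pairs of distinct $i,j\in E$ with $q_{ij}=0$, and let $V_1,\dots,V_k\subseteq E$ be the vertex sets of the maximal cliques of $G'$. For each $i$ let $v_i$ be the weight of a maximum-weight matching, with respect to the edge weights $b$, of the subgraph $G[V_i]$ of $G$ with edge set $V_i$. Then $\nu$ has a non-empty core if and only if $$\max_{x\in\mathbb{R}^m_+}\left[b^Tx:\ Ax\le\mathbf{1}_n\right]=\max\{v_1,\dots,v_k\}.$$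
   Context: Notation: $[n]=\{1,\dots,n\}$; $\mathbf{1}_n$ is the all-one vector; $\mathbb{R}^m_+$ is the set of componentwise non-negative vectors; $A_{ij}=1$ if vertex $i$ is incident with edge $j$, and $0$ otherwise; vector inequalities are componentwise. Players are the vertices of $G$. The empty matching (weight $0$) is allowed. The core of a (revenue) game $\nu:\{0,1\}^n\to\mathbb{R}$ is $\mathrm{core}(\nu)=\{y\in\mathbb{R}^n:\mathbf{1}_n^Ty=\nu(\mathbf{1}_n),\ a^Ty\ge\nu(a)\ \forall a\in\{0,1\}^n\}$. *)

(* Defs.v *)
From mathcomp Require Export all_boot all_order all_algebra.
From mathcomp Require Export boolp classical_sets reals.
From mathcomp Require Import topology normedtype derive.

Set Implicit Arguments.
Unset Strict Implicit.
Unset Printing Implicit Defensive.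

Import Order.TTheory GRing.Theory Num.Theory.
Import numFieldNormedType.Exports.

Local Open Scope classical_set_scope.
Local Open Scope ring_scope.

(* Vertices are 'I_n and edges are 'I_m. There are no loops; parallel edges are
   allowed, a simple graph being one whose [ends] is injective. *)
Record graph (n m : nat) := Graph {
  ends :> 'I_m -> {set 'I_n};
  card_ends : forall j : 'I_m, #|ends j| = 2%N }.

Definition incidence (R : realType) n m (G : graph n m) : 'M[R]_(n, m) :=
  \matrix_(i, j) (i \in G j)%:R.

Definition vle (R : realType) n (u v : 'cV[R]_n) : bool :=
  [forall i, u i 0 <= v i 0].

Definition dot (R : realType) n (u v : 'cV[R]_n) : R := (u^T *m v) 0 0.

(* The elements of {0,1}^n are boolean vectors, so that they form a finType;
   [vec01] embeds them in R^n. *)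
Definition vec01 (R : realType) n (w : 'cV[bool]_n) : 'cV[R]_n :=
  map_mx (fun c : bool => c%:R) w.

Definition ones n : 'cV[bool]_n := const_mx true.

Definition core (R : realType) n (nu : 'cV[bool]_n -> R) : set 'cV[R]_n :=
  [set y | dot (vec01 R (ones n)) y = nu (ones n) /\
           forall a : 'cV[bool]_n, nu a <= dot (vec01 R a) y].

Definition quad_obj (R : realType) m (b : 'cV[R]_m) (Q : 'M[R]_m)
  (x : 'cV[R]_m) : R := dot b x + dot x (Q *m x).

(* The index 0 of the maximum is the value of x = 0, which is always feasible. *)
Definition qmatching_game (R : realType) n m (G : graph n m) (b : 'cV[R]_m)
    (Q : 'M[R]_m) (w : 'cV[bool]_n) : R :=
  \big[Num.max/0]_(x : 'cV[bool]_m |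
      vle (incidence R G *m vec01 R x) (vec01 R w)) quad_obj b Q (vec01 R x).

Definition compat_graph (R : realType) m (Q : 'M[R]_m) : rel 'I_m :=
  fun i j => (i != j) && (Q i j == 0).

Definition is_clique (T : finType) (e : rel T) (C : {set T}) : bool :=
  [forall i in C, forall j in C, (i != j) ==> e i j].

Definition maximal_clique (T : finType) (e : rel T) (C : {set T}) : bool :=
  maxset (is_clique e) C.

Definition is_matching n m (G : graph n m) (M : {set 'I_m}) : bool :=
  [forall i in M, forall j in M, (i != j) ==> [disjoint G i & G j]].

(* Maximum weight of a matching of the subgraph of G with edge set F; the
   index 0 of the maximum is the weight of the empty matching. *)
Definition max_matching_weight (R : realType) n m (G : graph n m)
    (b : 'cV[R]_m) (F : {set 'I_m}) : R :=
  \big[Num.max/0]_(M : {set 'I_m} | is_matching G M && (M \subset F))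
    \sum_(j in M) b j 0.

(* Some maximal clique exists (the empty set is a clique, and is the maximal
   one if m = 0), and all the weights are at least 0, hence the index 0. *)
Definition max_clique_matching_weight (R : realType) n m (G : graph n m)
    (b : 'cV[R]_m) (Q : 'M[R]_m) : R :=
  \big[Num.max/0]_(C : {set 'I_m} | maximal_clique (compat_graph Q) C)
    max_matching_weight G b C.

Definition lp_feasible (R : realType) n m (G : graph n m) : set 'cV[R]_m :=
  [set x | vle 0 x /\ vle (incidence R G *m x) (vec01 R (ones n))].

(* This supremum is a maximum, see [lp_max_attained]. *)
Definition lp_max (R : realType) n m (G : graph n m) (b : 'cV[R]_m) : R :=
  sup [set dot b x | x in lp_feasible G].

Lemma lp_max_attained (R : realType) n m (G : graph n m) (b : 'cV[R]_m) :
  exists2 x, lp_feasible G x &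
    dot b x = lp_max G b /\
    forall z, lp_feasible G z -> dot b z <= dot b x.
Proof.
pose S := [set v : 'rV[R]_m | lp_feasible G v^T].
have dotE (c : 'cV[R]_m) (v : 'rV[R]_m) : dot c v^T = \sum_j c j 0 * v 0 j.
  by rewrite /dot mxE; apply: eq_bigr => j _; rewrite !mxE.
have sum_cont (c : 'I_m -> R) :
    continuous (fun v : 'rV[R]_m => \sum_j c j * v 0 j).
  move=> v; apply: (@cvg_big _ _ _ _ _ _ _ (nbhs v)) => [|j _].
    exact: add_continuous.
  by apply: cvgM; [exact: cvg_cst | exact: coord_continuous].
have S0 : S 0.
  by split; apply/forallP => i; rewrite trmx0 ?mulmx0 !mxE //.
have Sbox v : S v -> forall j, `[0, 1]%classic (v 0 j).
  move=> [/forallP v0 /forallP v1] j; rewrite /= in_itv /=.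
  have := v0 j; rewrite !mxE => -> /=.
  have /card_gt0P[i iGj] : (0 < #|G j|)%N by rewrite card_ends.
  have := v1 i; rewrite !mxE; apply: le_trans.
  rewrite (bigD1 j) //= !mxE iGj mul1r lerDl; apply: sumr_ge0 => k _.
  by rewrite !mxE mulr_ge0 ?ler0n //; have := v0 k; rewrite !mxE.
have clS : closed S.
  have -> : S = \bigcap_j [set v : 'rV[R]_m | 0 <= v 0 j] `&`
      \bigcap_i [set v : 'rV[R]_m | \sum_j (incidence R G i j) * v 0 j <= 1].
    apply/seteqP; split => v.
      move=> [/forallP v0 /forallP v1]; split => i _ /=.
        by have := v0 i; rewrite !mxE.
      have := v1 i; rewrite !mxE; congr (_ <= _).
      by apply: eq_bigr => j _; rewrite !mxE.
    move=> [v0 v1]; split; apply/forallP => i.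
      by have := v0 i I; rewrite !mxE.
    have := v1 i I; rewrite /= !mxE; congr (_ <= _).
    by apply: eq_bigr => j _; rewrite !mxE.
  apply: closedI; apply: closed_bigI => i _.
    have /continuous_closedP cl : continuous (fun v : 'rV[R]_m => v 0 i).
      by move=> v; exact: coord_continuous.
    by have := cl _ (@closed_ge R 0).
  have /continuous_closedP cl := sum_cont (incidence R G i).
  by have := cl _ (@closed_le R 1).
have cS : compact S.
  have cbox : compact [set v : 'rV[R]_m | forall j, `[0, 1]%classic (v ord0 j)].
    have seg (j : 'I_m) : compact (`[0, 1]%classic : set R).
      exact: segment_compact.
    by have := @rV_compact R m (fun=> `[0, 1]%classic) seg.
  exact: subclosed_compact clS cbox Sbox.
have [|v Sv vmax] := @EVT_max_rV R m (fun v => dot b v^T) S (ex_intro _ _ S0) cS.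
  apply: continuous_subspaceT => v.
  by under eq_fun do rewrite dotE; exact: sum_cont.
have xmax z : lp_feasible G z -> dot b z <= dot b v^T.
  by move=> zS; rewrite -[z]trmxK; apply: vmax; rewrite inE /S /= trmxK.
move: Sv; rewrite inE => Sv.
exists v^T => //; split => //; apply/eqP; rewrite eq_le; apply/andP; split.
  apply: ub_le_sup; last by exists v^T.
  by exists (dot b v^T) => _ [z zS <-]; exact: xmax.
apply: ge_sup; first by exists (dot b v^T); exists v^T.
by move=> _ [z zS <-]; exact: xmax.
Qed.

(* Main.v *)
Require Import Defs.
From mathcomp Require Import all_boot all_order all_algebra.
From mathcomp Require Import boolp classical_sets reals.
From mathcomp Require Import ring lra.

Set Implicit Arguments.
Unset Strict Implicit.
Unset Printing Implicit Defensive.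

Import Order.TTheory GRing.Theory Num.Theory.
Local Open Scope classical_set_scope.
Local Open Scope ring_scope.

(** The value of the grand coalition lies between the two quantities that are
compared:
  [max_clique_matching_weight G b Q <= nu 1 <= lp_max G b].
The lower bound holds because a matching contained in a clique of the
compatibility graph has no quadratic cost, and the upper one because the
quadratic cost is nonpositive and matchings are feasible for the linear
relaxation. The equivalence then splits in two.

The core is nonempty if and only if [nu 1 = lp_max G b] ([core_nonempty_iff]).
An allocation in the core is nonnegative on each vertex and pays at least
[b_j] to the two ends of each edge [j], so that it is feasible for the dual of
the linear relaxation, and weak duality gives [lp_max G b <= nu 1]. Conversely,
an optimal solution of the dual bounds [nu w] for every coalition [w], and it
distributes exactly [nu 1] when [nu 1 = lp_max G b]. This needs strong duality
([lp_strong_duality]), which follows from a Farkas lemma ([farkas]) proved by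
Fourier-Motzkin elimination.

Finally [nu 1 = lp_max G b] if and only if the lower bound equals [lp_max G b]
too ([game_eq_lp_max_iff]): a matching [x] that is not a clique loses a
positive quadratic cost, so its value is strictly less than
[dot b x <= lp_max G b], while the value of a matching that is a clique is at
most the lower bound. *)

(** * The scalar product and the componentwise order *)

Lemma dotE (R : realType) n (u v : 'cV[R]_n) :
  dot u v = \sum_i u i 0 * v i 0.
Proof. by rewrite /dot mxE; apply: eq_bigr => i _; rewrite mxE. Qed.

Lemma dotC (R : realType) n (u v : 'cV[R]_n) : dot u v = dot v u.
Proof. by rewrite !dotE; apply: eq_bigr => i _; rewrite mulrC. Qed.

Lemma dotDr (R : realType) n (u v w : 'cV[R]_n) :
  dot u (v + w) = dot u v + dot u w.
Proof. by rewrite /dot mulmxDr mxE. Qed.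

Lemma dotZr (R : realType) n (u v : 'cV[R]_n) c :
  dot u (c *: v) = c * dot u v.
Proof. by rewrite /dot -scalemxAr mxE. Qed.

Lemma dotDl (R : realType) n (u v w : 'cV[R]_n) :
  dot (u + v) w = dot u w + dot v w.
Proof. by rewrite dotC dotDr !(dotC w). Qed.

Lemma dotZl (R : realType) n (u v : 'cV[R]_n) c :
  dot (c *: u) v = c * dot u v.
Proof. by rewrite dotC dotZr (dotC v). Qed.

Lemma dot_delta (R : realType) n (u : 'cV[R]_n) i :
  dot u (delta_mx i 0) = u i 0.
Proof.
rewrite dotE (bigD1 i) //= big1 ?addr0 => [|k /negPf ki].
  by rewrite !mxE !eqxx mulr1.
by rewrite mxE ki mulr0.
Qed.

Lemma dot_mulmx (R : realType) n m (A : 'M[R]_(n, m)) y x :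
  dot y (A *m x) = dot (A^T *m y) x.
Proof. by rewrite /dot trmx_mul trmxK mulmxA. Qed.

Lemma vleP (R : realType) n (u v : 'cV[R]_n) :
  reflect (forall i, u i 0 <= v i 0) (vle u v).
Proof. exact: forallP. Qed.

Lemma dot_ler (R : realType) n (y u v : 'cV[R]_n) :
  vle 0 y -> vle u v -> dot y u <= dot y v.
Proof.
move=> /vleP y0 /vleP uv; rewrite !dotE; apply: ler_sum => i _.
by apply: ler_wpM2l => //; have := y0 i; rewrite mxE.
Qed.

(** * The Farkas lemma by Fourier-Motzkin elimination *)

Lemma exists_between (R : realType) (L U : seq R) :
  {in L & U, forall l u, l <= u} ->
  exists t, {in L, forall l, l <= t} /\ {in U, forall u, t <= u}.
Proof.
elim: L => [_|l L IH LU].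
  elim: U => [|u U [t [_ tU]]]; first by exists 0.
  exists (Num.min u t); split=> // v; rewrite inE => /predU1P[->|/tU tv].
    by rewrite ge_min lexx.
  by rewrite ge_min tv orbT.
have [|t [Lt tU]] := IH.
  by move=> k u kL uU; apply: LU; rewrite // inE kL orbT.
exists (Num.max l t); split=> [k|u uU].
  by rewrite inE => /predU1P[->|/Lt kt]; rewrite le_max ?lexx // kt orbT.
by rewrite ge_max LU ?tU // mem_head.
Qed.

(** A pair [(u, be)] of a vector and a scalar stands for the linear inequality
[dot u y <= be] in the unknown [y]; [P] is a convex cone of such
inequalities. *)
Definition convex_cone (R : realType) n (P : 'cV[R]_n -> R -> Prop) :=
  forall c d u v be ga, 0 <= c -> 0 <= d -> P u be -> P v ga ->
    P (c *: u + d *: v) (c * be + d * ga).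

(** If some convex cone contains all the inequalities of a finite system [s] but
no contradiction [0 <= be] with [be < 0], then [s] is solvable. Taking for [P]
the cone generated by [s] gives the usual form; an arbitrary [P] avoids
explicit multipliers, since elimination only replaces inequalities by
nonnegative combinations of them, which are again in [P]. *)
Lemma farkas (R : realType) n (P : 'cV[R]_n -> R -> Prop)
    (s : seq ('cV[R]_n * R)) :
  convex_cone P -> {in s, forall p, P p.1 p.2} ->
  (forall be, P 0 be -> 0 <= be) ->
  exists y, {in s, forall p, dot p.1 y <= p.2}.
Proof.
move=> coneP Ps P0.
suff elim_var (r : seq 'I_n) :
    (forall p i, p \in s -> i \notin r -> p.1 i 0 = 0) ->
    exists y, {in s, forall p, dot p.1 y <= p.2}.
  by apply: (elim_var (enum 'I_n)) => p i _; rewrite mem_enum.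
(* [r] lists the unknowns that may still occur; each step eliminates one. *)
elim: r s Ps => [|i r IH] s Ps supp.
  exists 0 => p ps; have p10 : p.1 = 0.
    by apply/matrixP => i j; rewrite mxE ord1 (supp p).
  by rewrite p10 /dot mulmx0 mxE; apply: P0; rewrite -p10; exact: Ps.
(* [comb p q] cancels the unknown [i] between an inequality [p] that bounds it
   from above and an inequality [q] that bounds it from below. *)
pose comb (p q : 'cV[R]_n * R) : 'cV[R]_n * R :=
  ((- q.1 i 0) *: p.1 + p.1 i 0 *: q.1, (- q.1 i 0) * p.2 + p.1 i 0 * q.2).
pose pos := [seq p : 'cV[R]_n * R <- s | 0 < p.1 i 0].
pose neg := [seq p : 'cV[R]_n * R <- s | p.1 i 0 < 0].
pose zer := [seq p : 'cV[R]_n * R <- s | p.1 i 0 == 0].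
have [p|p k|y ys] := IH (zer ++ [seq comb p q | p <- pos, q <- neg]).
- rewrite mem_cat mem_filter => /orP[/andP[_ /Ps]//|].
  move=> /allpairsP[[p1 p2] /= []]; rewrite !mem_filter.
  move=> /andP[p10 /Ps P1] /andP[p20 /Ps P2] -> /=.
  by apply: coneP => //; rewrite ?oppr_ge0 ltW.
- rewrite mem_cat mem_filter => /orP[/andP[/eqP p0 ps] kr|].
    have [->//|ki] := eqVneq k i; apply: (supp p) => //.
    by rewrite inE negb_or ki.
  move=> /allpairsP[[p1 p2] /= []]; rewrite !mem_filter.
  move=> /andP[_ s1] /andP[_ s2] -> kr /=; rewrite !mxE.
  have [->|ki] := eqVneq k i; first by ring.
  by rewrite (supp p1 k) ?(supp p2 k) ?inE ?negb_or ?ki // !mulr0 addr0.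
(* Given the other unknowns, [bound p] is the bound that [p] puts on the value
   to be added to the unknown [i]. *)
pose bound (p : 'cV[R]_n * R) := (p.2 - dot p.1 y) / p.1 i 0.
have [l u|t [lt tu]] := @exists_between R (map bound neg) (map bound pos).
  move=> /mapP[q qneg ->] /mapP[p ppos ->].
  have := ys (comb p q); rewrite mem_cat.
  rewrite (_ : comb p q \in [seq comb p q | p <- pos, q <- neg]); last first.
    by apply/allpairsP; exists (p, q).
  rewrite orbT dotDl !dotZl /bound => /(_ isT) /=.
  move: qneg ppos; rewrite !mem_filter => /andP[q0 _] /andP[p0 _] H.
  rewrite ler_pdivlMr // mulrAC ler_ndivrMr //; lra.
exists (y + t *: delta_mx i 0) => p ps; rewrite dotDr dotZr dot_delta.
rewrite -lerBrDl; case: (ltgtP (p.1 i 0) 0) => p0.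
- by rewrite -ler_ndivrMr //; apply/lt/map_f; rewrite mem_filter p0.
- by rewrite -ler_pdivlMr //; apply/tu/map_f; rewrite mem_filter p0.
- rewrite p0 mulr0 subr_ge0; apply: ys.
  by rewrite mem_cat mem_filter p0 eqxx ps.
Qed.

(** * Duality for the fractional matching problem *)

(** [y] is feasible for the dual of [lp_max G b]: it is a fractional vertex
cover, nonnegative and of total at least [b j] on the ends of each edge [j]. *)
Definition dual_feasible (R : realType) n m (G : graph n m) (b : 'cV[R]_m)
    (y : 'cV[R]_n) : bool :=
  vle 0 y && vle b ((incidence R G)^T *m y).

Lemma lp_weak_duality (R : realType) n m (G : graph n m) (b : 'cV[R]_m) w x y :
  dual_feasible G b y -> vle 0 x -> vle (incidence R G *m x) w ->
  dot b x <= dot w y.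
Proof.
move=> /andP[y0 by_] x0 xw; rewrite [leRHS]dotC.
by apply: le_trans (dot_ler y0 xw); rewrite dot_mulmx !(dotC _ x) dot_ler.
Qed.

Lemma lp_max_ge (R : realType) n m (G : graph n m) (b x : 'cV[R]_m) :
  lp_feasible G x -> dot b x <= lp_max G b.
Proof. by have [x0 _ [<- +]] := lp_max_attained G b; exact. Qed.

(** Only one inequality is stated, the other being [lp_weak_duality]. *)
Lemma lp_strong_duality (R : realType) n m (G : graph n m) (b : 'cV[R]_m) :
  exists2 y, dual_feasible G b y & dot (vec01 R (ones n)) y <= lp_max G b.
Proof.
set A := incidence R G; set e := vec01 R (ones n); set L := lp_max G b.
(* The system asks for a dual feasible [y] of total at most [L]. In [P], [t] and
   [x] are the multipliers of the bound on the total and of the edge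
   constraints; those of [0 <= y] are the slack in the inequality. *)
pose P (u : 'cV[R]_n) (be : R) := exists t x,
  [/\ 0 <= t, vle 0 x, vle (u + A *m x) (t *: e) & be = t * L - dot b x].
pose s := [:: (e, L)] ++ [seq (- delta_mx i 0, 0) | i <- enum 'I_n]
  ++ [seq (- (A *m delta_mx j 0), - b j 0) | j <- enum 'I_m].
have [||be|y ys] := @farkas R n P s.
- move=> c d u v be ga c0 d0 [t [x [t0 /vleP x0 /vleP ux ->]]].
  move=> [t' [x' [t'0 /vleP x'0 /vleP ux' ->]]].
  exists (c * t + d * t'), (c *: x + d *: x'); split.
  + by rewrite addr_ge0 ?mulr_ge0.
  + apply/vleP => i; rewrite !mxE addr_ge0 ?mulr_ge0 //.
      by have := x0 i; rewrite mxE.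
    by have := x'0 i; rewrite mxE.
  + rewrite mulmxDr -!scalemxAr.
    move: (A *m x) (A *m x') ux ux' => z z' ux ux'; apply/vleP => i.
    have := ler_wpM2l d0 (ux' i); have := ler_wpM2l c0 (ux i).
    by rewrite !mxE; lra.
  + by rewrite dotDr !dotZr; ring.
- move=> p; rewrite !mem_cat => /or3P[].
  + rewrite inE => /eqP-> /=; exists 1, 0; split=> //.
    * by apply/vleP.
    * by rewrite mulmx0 addr0 scale1r; apply/vleP.
    * by rewrite dotC dotE big1 ?subr0 ?mul1r // => i _; rewrite mxE mul0r.
  + move=> /mapP[i _ ->] /=; exists 0, 0; split=> //.
    * by apply/vleP.
    * rewrite mulmx0 addr0 scale0r; apply/vleP => k.
      by rewrite !mxE oppr_le0 ler0n.
    * by rewrite /dot mulmx0 mxE; ring.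
  + move=> /mapP[j _ ->] /=; exists 0, (delta_mx j 0); split=> //.
    * by apply/vleP => k; rewrite !mxE ler0n.
    * by rewrite addNr scale0r; apply/vleP.
    * by rewrite dot_delta; ring.
- move=> [t [x [t0 x0 Ax ->]]]; rewrite add0r in Ax.
  (* If [t * L < dot b x], moving from an optimal [z] to [(z + x) / (1 + t)]
     would improve it; this covers the case [t = 0] as well. *)
  have [z [z0 Az] [bz _]] := lp_max_attained G b.
  have t1 : 0 < 1 + t by lra.
  have : lp_feasible G ((1 + t)^-1 *: (z + x)).
    split.
      apply/vleP => j; have := vleP _ _ x0 j; have := vleP _ _ z0 j.
      by rewrite !mxE => *; rewrite mulr_ge0 ?addr_ge0 // invr_ge0 ltW.
    rewrite -scalemxAr mulmxDr; apply/vleP => i; rewrite -/A -/e.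
    move: (A *m z) (A *m x) Az Ax => u v /vleP/(_ i) + /vleP/(_ i).
    by rewrite !mxE => ? ?; rewrite mulrC ler_pdivrMr //; lra.
  move=> /(lp_max_ge b); rewrite dotZr dotDr bz -/L mulrC ler_pdivrMr //.
  lra.
exists y.
  apply/andP; split; apply/vleP => i.
    have := ys (- delta_mx i 0, 0); rewrite !mem_cat orbA orbC orbA.
    rewrite (map_f (fun i => (- delta_mx i 0, 0))) ?mem_enum // orbT.
    by rewrite /= -scaleN1r dotZl dotC dot_delta mxE mulN1r oppr_le0; exact.
  have := ys (- (A *m delta_mx i 0), - b i 0); rewrite !mem_cat.
  rewrite (map_f (fun j => (- (A *m delta_mx j 0), - b j 0))) ?mem_enum //.
  rewrite !orbT /= -scaleN1r dotZl dotC dot_mulmx dot_delta mulN1r lerN2.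
  exact.
by have := ys (e, L); rewrite !mem_cat mem_head; exact.
Qed.

(** * Matchings and cliques as 0-1 vectors *)

(** The set of edges encoded by a 0-1 vector, and the vector of a set. *)
Definition edge_set m (x : 'cV[bool]_m) : {set 'I_m} := [set j | x j 0].

Definition edge_vec m (M : {set 'I_m}) : 'cV[bool]_m := \col_j (j \in M).

Lemma edge_vecK m : cancel (@edge_vec m) (@edge_set m).
Proof. by move=> M; apply/setP => j; rewrite inE mxE. Qed.

Lemma vec01E (R : realType) n (w : 'cV[bool]_n) i :
  vec01 R w i 0 = (w i 0)%:R.
Proof. by rewrite mxE. Qed.

Lemma vec01_ge0 (R : realType) n (w : 'cV[bool]_n) : vle 0 (vec01 R w).
Proof. by apply/vleP => i; rewrite vec01E mxE ler0n. Qed.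

Lemma dot_vec01r (R : realType) m (u : 'cV[R]_m) (x : 'cV[bool]_m) :
  dot u (vec01 R x) = \sum_(j in edge_set x) u j 0.
Proof.
rewrite dotE [RHS]big_mkcond; apply: eq_bigr => j _; rewrite vec01E inE.
by case: (x j 0); rewrite ?mulr1 ?mulr0.
Qed.

Lemma incidence_vec01 (R : realType) n m (G : graph n m) (x : 'cV[bool]_m) i :
  (incidence R G *m vec01 R x) i 0 = #|[set j in edge_set x | i \in G j]|%:R.
Proof.
rewrite mxE -sum1_card natr_sum [RHS]big_mkcond; apply: eq_bigr => j _.
by rewrite !mxE !inE andbC; case: (i \in G j); case: (x j 0);
  rewrite ?mulr1 ?mulr0 ?mul0r.
Qed.

Lemma feasible_matching (R : realType) n m (G : graph n m) (x : 'cV[bool]_m) :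
  vle (incidence R G *m vec01 R x) (vec01 R (ones n)) =
  is_matching G (edge_set x).
Proof.
apply/vleP/forall_inP => [Gx j jx|Mx i].
  apply/forall_inP => k kx; apply/implyP => jk.
  rewrite finset.disjoints_subset; apply/fintype.subsetP => i ij; rewrite inE.
  apply: contraNN jk => ik; have := Gx i.
  rewrite incidence_vec01 vec01E mxE (ler_nat _ _ 1) => /card_le1_eqP le1.
  apply/eqP; apply: le1;
    by rewrite !inE ?ij ?ik andbT; move: jx kx; rewrite !inE.
rewrite incidence_vec01 vec01E mxE (ler_nat _ _ 1); apply/card_le1_eqP => j k.
rewrite !(inE, inE) => /andP[jx ij] /andP[kx ik]; apply/eqP/negPn/negP => kj.
have /(_ j) := Mx; rewrite inE => /(_ jx) /forall_inP/(_ k).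
rewrite inE => /(_ kx)/implyP; rewrite eq_sym => /(_ kj).
by move=> /disjointFr -/(_ i ij); rewrite ik.
Qed.

Lemma quad_le0 (R : realType) m (Q : 'M[R]_m) (x : 'cV[bool]_m) :
  (forall i j, Q i j <= 0) -> dot (vec01 R x) (Q *m vec01 R x) <= 0.
Proof.
move=> Qneg; rewrite dotC dot_vec01r; apply: sumr_le0 => i _.
rewrite mxE; apply: sumr_le0 => j _.
by rewrite vec01E mulr_le0_ge0 ?ler0n.
Qed.

(** As all the terms of the quadratic form are nonpositive, it vanishes at a 0-1
vector only if the edges chosen are pairwise compatible. *)
Lemma quad_eq0_clique (R : realType) m (Q : 'M[R]_m) (x : 'cV[bool]_m) :
  (forall i, Q i i = 0) -> (forall i j, Q i j <= 0) ->
  (dot (vec01 R x) (Q *m vec01 R x) == 0) =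
  is_clique (compat_graph Q) (edge_set x).
Proof.
move=> Qdiag Qneg.
have -> : dot (vec01 R x) (Q *m vec01 R x) =
    - \sum_(i in edge_set x) \sum_(j in edge_set x) - Q i j.
  rewrite dotC dot_vec01r -sumrN; apply: eq_bigr => i _.
  rewrite -sumrN mxE [RHS]big_mkcond; apply: eq_bigr => j _; rewrite vec01E inE.
  by case: (x j 0); rewrite ?mulr1 ?mulr0 ?opprK.
rewrite oppr_eq0; apply/eqP/forall_inP => [Q0 i ix|Cx].
  apply/forall_inP => j jx; apply/implyP => ij; rewrite /compat_graph ij /=.
  rewrite -oppr_eq0; apply/eqP.
  have Qge0 k l : 0 <= - Q k l by rewrite oppr_ge0.
  have Qi := psumr_eq0P (fun k _ => sumr_ge0 _ (fun l _ => Qge0 k l)) Q0 ix.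
  exact: (psumr_eq0P (fun l _ => Qge0 i l) Qi).
rewrite big1 // => i ix; rewrite big1 // => j jx.
have [->|ij] := eqVneq i j; first by rewrite Qdiag oppr0.
have /forall_inP/(_ j jx)/implyP/(_ ij)/andP[_ /eqP->] := Cx i ix.
by rewrite oppr0.
Qed.

Lemma quad_obj_le (R : realType) m (b : 'cV[R]_m) (Q : 'M[R]_m) x :
  (forall i j, Q i j <= 0) -> quad_obj b Q (vec01 R x) <= dot b (vec01 R x).
Proof. by move=> Qneg; rewrite /quad_obj gerDl quad_le0. Qed.

(** * The game, its core and the linear relaxation *)

Lemma game_ge0 (R : realType) n m (G : graph n m)
    (b : 'cV[R]_m) (Q : 'M[R]_m) w :
  0 <= qmatching_game G b Q w.
Proof. exact: bigmax_ge_id. Qed.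

Lemma quad_obj_le_game (R : realType) n m (G : graph n m)
    (b : 'cV[R]_m) (Q : 'M[R]_m) w x :
  vle (incidence R G *m vec01 R x) (vec01 R w) ->
  quad_obj b Q (vec01 R x) <= qmatching_game G b Q w.
Proof. by move=> xw; exact: le_bigmax_cond. Qed.

Lemma dual_feasible_game_le (R : realType) n m (G : graph n m)
    (b : 'cV[R]_m) (Q : 'M[R]_m) w y :
  (forall i j, Q i j <= 0) -> dual_feasible G b y ->
  qmatching_game G b Q w <= dot (vec01 R w) y.
Proof.
move=> Qneg dy; apply: bigmax_le => [|x xw].
  case/andP: dy => y0 _; rewrite dotC.
  by apply: le_trans (dot_ler y0 (vec01_ge0 R w)); rewrite /dot mulmx0 mxE.
apply: le_trans (quad_obj_le _ _ Qneg) _.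
exact: lp_weak_duality dy (vec01_ge0 R x) xw.
Qed.

Lemma game_ones_le_lp_max (R : realType) n m (G : graph n m)
    (b : 'cV[R]_m) (Q : 'M[R]_m) :
  (forall i j, Q i j <= 0) -> qmatching_game G b Q (ones n) <= lp_max G b.
Proof.
have [y dy yL] := lp_strong_duality G b.
by move=> Qneg; apply: le_trans yL; exact: dual_feasible_game_le.
Qed.

Lemma core_dual_feasible (R : realType) n m (G : graph n m)
    (b : 'cV[R]_m) (Q : 'M[R]_m) y :
  (forall i, Q i i = 0) -> core (qmatching_game G b Q) y ->
  dual_feasible G b y.
Proof.
move=> Qdiag [_ ycore]; apply/andP; split; apply/vleP => i.
  rewrite mxE (le_trans (game_ge0 G b Q (edge_vec [set i]))) //.
  rewrite (le_trans (ycore _)) // dotC dot_vec01r edge_vecK big_set1 //.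
(* The coalition of the two ends of the edge [i] can realise the matching
   [{i}], of value [b i 0]. *)
have e1 : vec01 R (edge_vec [set i]) = delta_mx i 0.
  by apply/matrixP => k l; rewrite !mxE inE ord1 andbT.
have -> : ((incidence R G)^T *m y) i 0 = dot (vec01 R (edge_vec (G i))) y.
  by rewrite mxE dotE; apply: eq_bigr => k _; rewrite !mxE.
apply: le_trans (ycore _).
have -> : b i 0 = quad_obj b Q (vec01 R (edge_vec [set i])).
  rewrite /quad_obj e1 dot_delta dotC dot_delta -colE mxE Qdiag addr0.
  by [].
apply: quad_obj_le_game; apply/vleP => k; rewrite incidence_vec01 edge_vecK.
rewrite vec01E mxE; have [kG|kG] := boolP (k \in G i).
  rewrite ler_nat /= -(cards1 i); apply/subset_leq_card/fintype.subsetP => j.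
  by rewrite !inE => /andP[].
rewrite ler_nat leqn0 cards_eq0; apply/eqP/setP => j; rewrite !inE.
by case: eqP => // ->; apply/negbTE.
Qed.

Lemma core_nonempty_iff (R : realType) n m (G : graph n m)
    (b : 'cV[R]_m) (Q : 'M[R]_m) :
  (forall i, Q i i = 0) -> (forall i j, Q i j <= 0) ->
  core (qmatching_game G b Q) !=set0 <->
  qmatching_game G b Q (ones n) = lp_max G b.
Proof.
move=> Qdiag Qneg; split=> [[y ycore]|gameL].
  apply/eqP; rewrite eq_le game_ones_le_lp_max //=.
  have [x [x0 x1] [<- _]] := lp_max_attained G b; case: (ycore) => <- _.
  exact: lp_weak_duality (core_dual_feasible Qdiag ycore) x0 x1.
have [y dy yL] := lp_strong_duality G b; exists y.
have game_le a := dual_feasible_game_le a Qneg dy.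
by split=> //; apply/eqP; rewrite eq_le game_le gameL yL.
Qed.

Lemma clique_weight_le_game (R : realType) n m (G : graph n m)
    (b : 'cV[R]_m) (Q : 'M[R]_m) :
  (forall i, Q i i = 0) -> (forall i j, Q i j <= 0) ->
  max_clique_matching_weight G b Q <= qmatching_game G b Q (ones n).
Proof.
move=> Qdiag Qneg; apply: bigmax_le => [|C /maxsetp cC]; first exact: game_ge0.
apply: bigmax_le => [|M /andP[mM MC]]; first exact: game_ge0.
(* A subset of a clique is a clique, so that [M] has no quadratic cost. *)
rewrite -{1}[M]edge_vecK -dot_vec01r.
have /eqP M0 : dot (vec01 R (edge_vec M)) (Q *m vec01 R (edge_vec M)) == 0.
  rewrite quad_eq0_clique // edge_vecK; apply/forall_inP => i iM.
  apply/forall_inP => j jM; move/fintype.subsetP: MC => MC.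
  by have /forall_inP/(_ i (MC i iM))/forall_inP/(_ j (MC j jM)) := cC.
have -> : dot b (vec01 R (edge_vec M)) = quad_obj b Q (vec01 R (edge_vec M)).
  by rewrite /quad_obj M0 addr0.
by apply: quad_obj_le_game; rewrite feasible_matching edge_vecK.
Qed.

Lemma clique_weight_ge (R : realType) n m (G : graph n m)
    (b : 'cV[R]_m) (Q : 'M[R]_m) M :
  is_matching G M -> is_clique (compat_graph Q) M ->
  \sum_(j in M) b j 0 <= max_clique_matching_weight G b Q.
Proof.
move=> mM /maxset_exists[C cC MC].
apply: le_trans (le_bigmax_cond _ _ cC).
by apply: (@le_bigmax_cond _ _ _ _ M); rewrite mM.
Qed.

Lemma game_eq_lp_max_iff (R : realType) n m (G : graph n m)
    (b : 'cV[R]_m) (Q : 'M[R]_m) :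
  (forall i, Q i i = 0) -> (forall i j, Q i j <= 0) ->
  qmatching_game G b Q (ones n) = lp_max G b <->
  lp_max G b = max_clique_matching_weight G b Q.
Proof.
move=> Qdiag Qneg; have cg := clique_weight_le_game G b Qdiag Qneg.
have gL := game_ones_le_lp_max G b Qneg.
split=> [gameL|Lc]; last by apply/eqP; rewrite eq_le gL Lc.
apply/eqP; rewrite eq_le -{2}gameL cg andbT leNgt; apply/negP => cL.
suff : qmatching_game G b Q (ones n) < lp_max G b by rewrite gameL ltxx.
apply: bigmax_lt => [|x xf].
  by apply: le_lt_trans cL; exact: bigmax_ge_id.
have xle : dot b (vec01 R x) <= lp_max G b.
  by apply: lp_max_ge; split=> //; exact: vec01_ge0.
have [cx|ncx] := boolP (is_clique (compat_graph Q) (edge_set x)).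
  apply: le_lt_trans cL; apply: le_trans (quad_obj_le b x Qneg) _.
  by rewrite dot_vec01r clique_weight_ge // -(feasible_matching R).
apply: lt_le_trans xle; rewrite /quad_obj gtrDl lt_neqAle quad_le0 // andbT.
by rewrite quad_eq0_clique.
Qed.

Theorem proposition3 (R : realType) (n m : nat) (G : graph n m)
    (b : 'cV[R]_m) (Q : 'M[R]_m)
    (Qsym : Q^T = Q)
    (Qdiag : forall i : 'I_m, Q i i = 0)
    (Qneg : forall i j : 'I_m, Q i j <= 0) :
  core (qmatching_game G b Q) !=set0 <->
  lp_max G b = max_clique_matching_weight G b Q.
Proof.
apply: iff_trans (core_nonempty_iff G b Qdiag Qneg) _.
exact: game_eq_lp_max_iff.
Qed.
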